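(* Let $T$ be an ergodic interval exchange transformation of $[0,1)$ (ergodic with respect to Lebesgue measure). Then $T$ is partially rigid.
   Context: An interval exchange transformation (IET) is a bijection of $[0,1)$ that permutes by translations the members of a finite partition of $[0,1)$ into half-open intervals; it preserves Lebesgue measure $\mu$. **Partial rigidity**: there are $\delta>0$ and an increasing sequence of integers $(m_n)$ such that $\liminf_{n\to\infty}\mu(A\cap T^{m_n}A)\ge\delta\mu(A)$ for each Borel set $A\subset[0,1)$. *)

(* Defs.v *)
From HB Require Import structures.
From mathcomp Require Import all_boot all_order all_algebra.
From mathcomp Require Import all_classical all_reals all_analysis.

Set Implicit Arguments.
Unset Strict Implicit.
Unset Printing Implicit Defensive.

Import Order.TTheory GRing.Theory Num.Theory.
Import numFieldNormedType.Exports.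

Local Open Scope classical_set_scope.
Local Open Scope ring_scope.

(* Transformations of [0,1) are represented by total functions R -> R; only
   their values on [0,1) matter in the definitions below. *)
Definition unit_itv (R : realType) : set R := `[0, 1[.
Arguments unit_itv : clear implicits.

(* The exchanged intervals are I_k = [a k, b k) and T is the translation by
   t k on I_k. As T is a bijection of [0,1), the images [a k + t k, b k + t k)
   again form a partition of [0,1) into half-open intervals. *)
Definition interval_exchange (R : realType) (T : R -> R) : Prop :=
  set_bij (unit_itv R) (unit_itv R) T /\
  exists (n : nat) (a b t : 'I_n -> R),
    partition [set: 'I_n] (fun k => `[a k, b k[%classic) (unit_itv R) /\
    forall (k : 'I_n) (x : R), x \in `[a k, b k[ -> T x = x + t k.

(* Invariance of mu under T is not part of the definition: it holds for every
   interval exchange. *)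
Definition ergodic (R : realType) (T : R -> R) : Prop :=
  forall A : set (measurableTypeR R),
    measurable A -> A `<=` unit_itv R -> unit_itv R `&` T @^-1` A = A ->
    (lebesgue_measure A = 0 \/ lebesgue_measure A = 1)%E.

Definition partially_rigid (R : realType) (T : R -> R) : Prop :=
  exists (delta : R) (m : nat -> nat),
    [/\ 0 < delta, increasing_seq m &
      forall A : set (measurableTypeR R),
        measurable A -> A `<=` unit_itv R ->
        (delta%:E * lebesgue_measure A <=
         limn_einf (fun n => lebesgue_measure (A `&` (iter (m n) T @` A))))%E].

(* Main.v *)
Require Import Defs.
From HB Require Import structures.
From mathcomp Require Import all_boot all_order all_algebra.
From mathcomp Require Import all_classical all_reals all_analysis.
From mathcomp Require Import measurable_realfun ring lra zify.

(* The proof follows Katok's argument against mixing. For a half-open interval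
   J, the first return time to J takes boundedly many values: J splits into at
   most N pieces (N depending only on T) on which all iterates up to the return
   are translations. Take J tiny. By ergodicity the towers over the pieces of J
   fill [0,1), so one of them, of base I and height h, has measure >= 1/N.
   Splitting I in turn, one piece B, of return time r to I, has length
   >= |I|/N. On the part C of the tower over B below height h, which has
   measure >= 1/N^2, T^r moves every point by less than |I|. Moreover C is
   invariant up to a set of measure |B|; any ultralimit of A |-> mu(A /\ C)
   as |J| -> 0 is hence a T-invariant measure dominated by mu, and by ergodicity
   it is a multiple of mu. So these sets C meet every Borel set A in a definite
   proportion, and on that proportion T^r returns to A up to a small error. *)

Set Implicit Arguments.
Unset Strict Implicit.
Unset Printing Implicit Defensive.

Import Order.TTheory GRing.Theory Num.Theory.
Import numFieldNormedType.Exports.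

Local Open Scope classical_set_scope.
Local Open Scope ring_scope.

(** * Lebesgue measure on the unit interval *)

Section volume.
Context {R : realType}.
Implicit Types A B : set R.

(* Cutting by [0,1) makes [vol] finite on all measurable sets, so that sums and
   differences can be taken in R rather than in the extended reals. *)
Definition vol A : R := fine (lebesgue_measure (A `&` unit_itv R)).

Lemma measurable_unit_itv : measurable (unit_itv R).
Proof. exact: measurable_itv. Qed.
#[local] Hint Resolve measurable_unit_itv : core.

Lemma lebesgue_unit_itv : lebesgue_measure (unit_itv R) = 1%E.
Proof. by rewrite /unit_itv lebesgue_measure_itv/= lte01 sube0. Qed.

Lemma volEI A : measurable A ->
  lebesgue_measure (A `&` unit_itv R) = (vol A)%:E.
Proof.
move=> mA; rewrite /vol fineK// ge0_fin_numE ?measure_ge0//.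
have le1 : (lebesgue_measure (A `&` unit_itv R) <= 1)%E.
  by rewrite -lebesgue_unit_itv; apply: measureIr.
by apply: le_lt_trans le1 _; rewrite ltry.
Qed.

Lemma volE A : measurable A -> A `<=` unit_itv R ->
  lebesgue_measure A = (vol A)%:E.
Proof. by move=> mA AX; rewrite -volEI// (setIidl AX). Qed.

Lemma vol_ge0 A : 0 <= vol A.
Proof. exact/fine_ge0/measure_ge0. Qed.

Lemma le_vol A B : measurable A -> measurable B -> A `<=` B -> vol A <= vol B.
Proof.
move=> mA mB AB; rewrite -lee_fin -!volEI//.
by apply: le_measure; rewrite ?inE; [exact: measurableI|exact: measurableI|exact: setSI].
Qed.

Lemma vol_le1 A : measurable A -> vol A <= 1.
Proof.
move=> mA; rewrite -lee_fin -volEI// -lebesgue_unit_itv.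
exact: measureIr.
Qed.

Lemma vol_unit : vol (unit_itv R) = 1.
Proof. by apply: EFin_inj; rewrite -volE// lebesgue_unit_itv. Qed.

Lemma vol0 : vol set0 = 0.
Proof. by rewrite /vol set0I measure0. Qed.

Lemma volU A B : measurable A -> measurable B -> A `&` B = set0 ->
  vol (A `|` B) = vol A + vol B.
Proof.
move=> mA mB AB; apply: EFin_inj; rewrite EFinD -!volEI ?setIUl//; last exact: measurableU.
rewrite measureU//; [exact: measurableI|exact: measurableI|].
by rewrite setIACA AB set0I.
Qed.

Lemma le_volU A B : measurable A -> measurable B ->
  vol (A `|` B) <= vol A + vol B.
Proof.
move=> mA mB; rewrite -lee_fin EFinD -!volEI ?setIUl//; last exact: measurableU.
by apply: measureU2; exact: measurableI.
Qed.

Lemma volDI A B : measurable A -> measurable B ->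
  vol A = vol (A `\` B) + vol (A `&` B).
Proof.
move=> mA mB; rewrite -volU ?(measurableD, measurableI)//.
- by rewrite setUC setUIDK.
- exact: measurableD.
- exact: measurableI.
- by rewrite setDE setIACA setICl setI0.
Qed.

Lemma vol_itv (u v : R) : 0 <= u -> u <= v -> v <= 1 -> vol `[u, v[ = v - u.
Proof.
move=> u0 uv v1; apply: EFin_inj; rewrite -volE//.
  by rewrite lebesgue_measure_itv/= lte_fin; move: uv; rewrite le_eqVlt => /orP[/eqP ->|->];
    rewrite ?ltxx ?subrr// -EFinD.
by move=> x; rewrite /unit_itv /= !in_itv/= => /andP[ux xv]; apply/andP; split; lra.
Qed.

Lemma vol_sum (n : nat) (F : 'I_n -> set R) : (forall i, measurable (F i)) ->
  trivIset setT F -> vol (\bigcup_i F i) = \sum_(i < n) vol (F i).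
Proof.
move=> mF tF; rewrite (_ : [set: 'I_n] = [set` predT]); last by apply/seteqP.
rewrite bigcup_pred; apply: EFin_inj.
rewrite -volEI; last by apply: bigsetU_measurable.
rewrite -sumEFin big_distrl/= measure_bigsetU_ord//.
- by apply: eq_bigr => i _; exact: volEI.
- by move=> i; apply: measurableI; [exact: mF|exact: measurable_unit_itv].
- exact: trivIset_setIr.
Qed.

Lemma vol_tower (n : nat) (F : nat -> set R) : (forall k, measurable (F k)) ->
  (forall i j, (i < j < n)%N -> F i `&` F j = set0) ->
  vol (\bigcup_(k < n) F k) = \sum_(k < n) vol (F k).
Proof.
move=> mF; elim: n => [|n IH] dF; first by rewrite bigcup_mkord !big_ord0 vol0.
rewrite bigcup_mkord !big_ord_recr/= -bigcup_mkord volU//.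
- by rewrite IH// => i j /andP[ij jn]; apply: dF; rewrite ij ltnS ltnW.
- by apply: bigcup_measurable.
- rewrite setI_bigcupl bigcup0// => i /= ni; apply: dF.
  by rewrite ni ltnSn.
Qed.

Lemma le_vol_sum (I : eqType) (s : seq I) (F : I -> set R) A : measurable A ->
  (forall i, i \in s -> measurable (F i)) ->
  (forall x, A x -> exists2 i, i \in s & F i x) ->
  vol A <= \sum_(i <- s) vol (F i).
Proof.
elim: s A => [|i s IH] A mA mF AF.
  by rewrite big_nil (_ : A = set0) ?vol0// -subset0 => x /AF[].
have mFi : measurable (F i) by apply: mF; rewrite mem_head.
rewrite big_cons (volDI mA mFi) addrC lerD//.
  by apply: le_vol => //; exact: measurableI.
apply: IH; first exact: measurableD.
  by move=> j js; apply: mF; rewrite inE js orbT.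
move=> x [Ax nFx]; have [j] := AF x Ax.
by rewrite inE => /predU1P[->//|js] Fj; exists j.
Qed.

Lemma vol_cvg0 (F : nat -> set R) : (forall n, measurable (F n)) ->
  nonincreasing_seq F -> \bigcap_n F n = set0 -> vol (F n) @[n --> \oo] --> 0.
Proof.
move=> mF dF F0; apply: fine_cvg.
have F0' : lebesgue_measure (\bigcap_n (F n `&` unit_itv R)) = 0%E.
  by rewrite bigcapIl// F0 set0I measure0.
rewrite -[0%:E]F0'.
apply: nonincreasing_cvg_mu.
- by rewrite [X in (X < _)%E](volEI (mF 0%N)) ltry.
- by move=> n; apply: measurableI; [exact: mF|exact: measurable_unit_itv].
- apply: bigcapT_measurable => n; apply: measurableI; first exact: mF.
  exact: measurable_unit_itv.
- by move=> n m nm; apply/subsetPset; apply: setSI; apply/subsetPset/dF.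
Qed.

End volume.

(** * Interval exchanges as piecewise translations *)

Section translation.
Context {R : realType}.
Implicit Types (A : set R) (t : R).

Lemma image_shift t A : (fun x => x + t) @` A = (fun x => x - t) @^-1` A.
Proof.
apply/seteqP; split => [_ [x Ax <-]|x Ax] /=; first by rewrite addrK.
by exists (x - t) => //; rewrite subrK.
Qed.

Lemma measurable_image_shift t A : measurable A ->
  measurable ((fun x => x + t) @` A).
Proof.
move=> mA; rewrite image_shift -[X in measurable X]setTI.
have mf : measurable_fun setT (fun x : R => x - t) by exact: measurable_funD.
exact: mf.
Qed.

(** The pushforward of Lebesgue measure by a translation agrees with it on half-open intervals, and
    these determine the measure. *)
Lemma lebesgue_measure_image_shift t A : measurable A ->
  lebesgue_measure ((fun x => x + t) @` A) = lebesgue_measure A.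
Proof.
move=> mA; rewrite image_shift; apply/esym.
have mf : measurable_fun setT (fun x : measurableTypeR R => x - t : measurableTypeR R).
  exact: measurable_funD.
pose m : {measure set (measurableTypeR R) -> \bar R} :=
  measure_function_pushforward__canonical__measure_function_Measure (@lebesgue_measure R) mf.
apply: (lebesgue_measure_unique (mu := m)) => // _ [[x y] _ <-].
rewrite /m/= /pushforward /=.
rewrite (_ : _ @^-1` _ = `]x + t, y + t]%classic); last first.
  by apply/seteqP; split => z /=; rewrite !in_itv/= ltrBrDr lerBlDr.
rewrite !lebesgue_measure_itv/= !lte_fin ltrD2r -!EFinD.
by rewrite (_ : y + t - (x + t) = y - x)//; ring.
Qed.

End translation.

(** [D] lists the break points: an interval with none of them in its interior is moved rigidly.
    Injectivity is asked on the whole line, so that iterates cancel without checking membership in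
    [0,1). *)
Definition piecewise_translation (R : realType) (D : seq R) (S : R -> R) :=
  [/\ injective S,
      forall x, unit_itv R x -> unit_itv R (S x),
      forall A, measurable A -> A `<=` unit_itv R ->
        measurable (S @` A) /\ vol (S @` A) = vol A,
      forall A, measurable A -> measurable (unit_itv R `&` S @^-1` A) &
      forall u v, `[u, v[%classic `<=` unit_itv R ->
        (forall d, d \in D -> ~ (u < d < v)) ->
        exists t, forall x, u <= x < v -> S x = x + t].

(** [S] is [T] extended by the identity outside [0,1), which makes it injective on the line; [D]
    consists of the left ends [a k]. *)
Lemma iet_piecewise_translation (R : realType) (T : R -> R) :
  interval_exchange T -> exists D S,
    piecewise_translation D S /\ forall x, unit_itv R x -> S x = T x.
Proof.
move=> [[TX Tinj _] [n [a [b [t [[cov triv ne] Ttr]]]]]].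
pose S x := if `[< unit_itv R x >] then T x else x.
have SE x : unit_itv R x -> S x = T x by rewrite /S; case: asboolP.
have SN x : ~ unit_itv R x -> S x = x by rewrite /S; case: asboolP.
have IX k x : `[a k, b k[%classic x -> unit_itv R x.
  by move=> kx; rewrite -cov; exists k.
have XI x : unit_itv R x -> exists k, `[a k, b k[%classic x.
  by rewrite -{1}cov => -[k _ kx]; exists k.
have Idisj i j x : `[a i, b i[%classic x -> `[a j, b j[%classic x -> i = j.
  by move=> ix jx; apply: (triv i j) => //; exists x.
have SX x : unit_itv R x -> unit_itv R (S x).
  by move=> Xx; rewrite SE//; exact: TX.
have St k x : `[a k, b k[%classic x -> S x = x + t k.
  by move=> kx; rewrite SE ?(Ttr k)//; exact: IX kx.
exists (map a (enum 'I_n)), S; split => //; split => //.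
- move=> x y; have [Xx|nXx] := pselect (unit_itv R x).
    have [Xy|nXy] := pselect (unit_itv R y).
      by rewrite !SE// => /Tinj; apply; rewrite inE.
    by rewrite (SN y)// => Sxy; case: nXy; rewrite -Sxy; exact: SX.
  have [Xy|nXy] := pselect (unit_itv R y); last by rewrite !SN.
  by rewrite (SN x)// => Sxy; case: nXx; rewrite Sxy; exact: SX.
- move=> A mA AX.
  pose B k := A `&` `[a k, b k[%classic.
  have mB k : measurable (B k) by apply: measurableI => //; exact: measurable_itv.
  have AB : A = \bigcup_k B k.
    apply/seteqP; split => [x Ax|x [k _ []]//].
    by have [k kx] := XI x (AX x Ax); exists k.
  have SB k : S @` B k = (fun x => x + t k) @` B k.
    by apply: eq_imagel => x [_ kx]; exact: St.
  have tB : trivIset setT B by apply: trivIset_setIl.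
  have SA : S @` A = \bigcup_k (S @` B k) by rewrite AB image_bigcup.
  have mSB k : measurable (S @` B k) by rewrite SB; exact: measurable_image_shift.
  split; first by rewrite SA; exact: fin_bigcup_measurable.
  rewrite SA [X in _ = vol X]AB !vol_sum//; last first.
    move=> i j _ _ [_ [[x [Ax ix] <-] [y [Ay jy] Sxy]]].
    have xy : x = y.
      by apply: Tinj; rewrite ?inE; [exact: AX|exact: AX|rewrite -!SE//; exact: AX].
    by apply: Idisj ix _; rewrite xy.
  apply: eq_bigr => k _; apply: EFin_inj; rewrite -!volE//.
  - by rewrite SB lebesgue_measure_image_shift.
  - by move=> x [Ax _]; exact: AX.
  - by move=> _ [x [Ax _] <-]; apply: SX; exact: AX.
- move=> A mA.
  suff -> : unit_itv R `&` S @^-1` A =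
      \bigcup_k (`[a k, b k[%classic `&` (fun x => x + - t k) @` A).
    apply: fin_bigcup_measurable => // k _.
    by apply: measurableI; [exact: measurable_itv|exact: measurable_image_shift].
  apply/seteqP; split => [x [Xx Ax]|x [k _ [kx]]].
    have [k kx] := XI x Xx; exists k => //; split => //.
    by exists (S x) => //; rewrite (St k)// addrK.
  rewrite image_shift /= opprK => Ax.
  by split; [exact: IX kx|rewrite /= (St k)].
- move=> u v uvX nD.
  have [uv|vu] := ltP u v; last first.
    by by exists 0 => x /andP[ux xv]; have := lt_le_trans (le_lt_trans ux xv) vu; rewrite ltxx.
  have uu : `[u, v[%classic u by rewrite /= in_itv/= lexx uv.
  have [k ku] := XI u (uvX u uu).
  (* If [b k < v], the interval [j] containing [b k] has its left end outside []u, v[], hence at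
     most [u]; then [u] lies in both intervals, so [j = k], against [b k < b j]. *)
  suff vb : v <= b k.
    exists (t k) => x /andP[ux xv]; apply: St.
    by move: ku; rewrite /= !in_itv/= => /andP[au ub]; apply/andP; split; lra.
  rewrite leNgt; apply/negP => bv.
  have [au ub] : a k <= u /\ u < b k by move: ku; rewrite /= in_itv/= => /andP.
  have [j jb] : exists j, `[a j, b j[%classic (b k).
    by apply: XI; apply: uvX; rewrite /= in_itv/= bv ltW.
  have [ab bb] : a j <= b k /\ b k < b j by move: jb; rewrite /= in_itv/= => /andP.
  have aju : a j <= u.
    rewrite leNgt; apply/negP => uaj; apply: (nD (a j)).
      by rewrite map_f// mem_enum.
    by rewrite uaj (le_lt_trans ab bv).
  have jk : j = k.
    by apply: (Idisj _ _ u) => //; rewrite /= in_itv/= aju (lt_trans ub bb).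
  by move: bb; rewrite jk ltxx.
Qed.

(** * First returns to an interval *)

Lemma itv_split (R : realType) (s : seq R) (p q : R) : p < q ->
  exists L : seq (R * R),
    [/\ (size L <= (size s).+1)%N,
        forall x, p <= x < q -> exists2 l, l \in L & l.1 <= x < l.2 &
        forall l, l \in L -> [/\ p <= l.1, l.1 < l.2, l.2 <= q &
          forall d, d \in s -> ~ l.1 < d < l.2]].
Proof.
have [n] := ubnP (size s); elim: n s p q => // n IH s p q; rewrite ltnS => sn pq.
have [/hasP[d ds /andP[pd dq]]|/hasPn nos] := boolP (has (fun d => p < d < q) s); last first.
  exists [:: (p, q)]; split => //.
  - by move=> x xpq; exists (p, q); rewrite ?inE.
  - move=> l; rewrite inE => /eqP -> /=; split=> // d ds.
    by apply/negP/nos.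
pose s1 := [seq x <- s | x < d]; pose s2 := [seq x <- s | d < x].
(* Copies of [d] are in neither list; this pays for the extra piece created by cutting at [d]. *)
have sz : (size s1 + size s2 < size s)%N.
  have <- : (size s1 + size s2 + count_mem d s = size s)%N.
    rewrite !size_filter; elim: {+}s => //= x r <-.
    by case: ltgtP => /= _; lia.
  by rewrite -addn1 leq_add2l -has_count has_pred1.
have [|L1 [sL1 c1 P1]] := IH s1 p d _ pd.
  by apply: leq_trans sn; apply: leq_ltn_trans sz; exact: leq_addr.
have [|L2 [sL2 c2 P2]] := IH s2 d q _ dq.
  by apply: leq_trans sn; apply: leq_ltn_trans sz; exact: leq_addl.
exists (L1 ++ L2); split.
- rewrite size_cat (leq_trans (leq_add sL1 sL2))// addSn addnS ltnS; exact: sz.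
- move=> x /andP[px xq]; have [xd|dx] := ltP x d.
    have [|l lL lx] := c1 x; first by rewrite px.
    by exists l; rewrite // mem_cat lL.
  have [|l lL lx] := c2 x; first by rewrite dx.
  by exists l; rewrite // mem_cat lL orbT.
- move=> l; rewrite mem_cat => /orP[/P1|/P2] [l1 l12 l2 ls]; split => //.
  + exact: le_trans l2 (ltW dq).
  + move=> e es /andP[le el]; apply: (ls e); last by rewrite le.
    by rewrite mem_filter es andbT (lt_le_trans el).
  + exact: le_trans (ltW pd) l1.
  + move=> e es /andP[le el]; apply: (ls e); last by rewrite le.
    by rewrite mem_filter es andbT (le_lt_trans l1).
Qed.

(** Meant for the relation between a point and its first entry: an end or break point yields at most
    one cut, possibly none. *)
Lemma functional_image_seq (T U : eqType) (B : T -> U -> Prop) (ds : seq T) :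
  (forall d c c', B d c -> B d c' -> c = c') ->
  exists s : seq U, (size s <= size ds)%N /\
    forall d c, d \in ds -> B d c -> c \in s.
Proof.
move=> Bfun; elim: ds => [|d ds [s [ss sB]]]; first by exists [::].
have [[c Bc]|nB] := pselect (exists c, B d c).
  exists (c :: s); split => // e b; rewrite !inE => /predU1P[->|eds] Be.
    by rewrite (Bfun _ _ _ Be Bc) eqxx.
  by rewrite (sB _ _ eds Be) orbT.
exists s; split; first exact: leqW.
by move=> e b; rewrite inE => /predU1P[->|eds] Be; [case: nB; exists b|exact: sB Be].
Qed.

Section dynamics.
Context {R : realType} (S : R -> R) (D : seq R).

Definition measure_preserving_injection :=
  [/\ injective S, forall x, unit_itv R x -> unit_itv R (S x),
      forall A, measurable A -> A `<=` unit_itv R ->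
        measurable (S @` A) /\ vol (S @` A) = vol A &
      forall A, measurable A -> measurable (unit_itv R `&` S @^-1` A)].

Section preserving.
Hypothesis pS : measure_preserving_injection.

Lemma iter_inj_preserving k : injective (iter k S).
Proof. by case: pS => Sinj _ _ _; elim: k => //= k IH x y /Sinj /IH. Qed.

Lemma iter_unit_itv k x : unit_itv R x -> unit_itv R (iter k S x).
Proof. by case: pS => _ SX _ _ Xx; elim: k => //= k IH; exact: SX. Qed.

Lemma iter_image_sub k A : A `<=` unit_itv R -> iter k S @` A `<=` unit_itv R.
Proof. by move=> AX _ [x /AX Xx <-]; exact: iter_unit_itv. Qed.

Lemma iter_imageS k A : iter k.+1 S @` A = S @` (iter k S @` A).
Proof. by rewrite -image_comp. Qed.

Lemma iter_image_preserving k A : measurable A -> A `<=` unit_itv R ->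
  measurable (iter k S @` A) /\ vol (iter k S @` A) = vol A.
Proof.
case: pS => _ _ Sp _ mA AX; elim: k => [|k [mk vk]]; first by rewrite image_id.
by rewrite iter_imageS; have [? ->] := Sp _ mk (iter_image_sub (k:=k) AX).
Qed.

Lemma iter_preimage_measurable k A : measurable A ->
  measurable (unit_itv R `&` iter k S @^-1` A).
Proof.
case: pS => _ SX _ Sm mA; elim: k => [|k IH].
  exact: measurableI (measurable_itv _) mA.
suff -> : unit_itv R `&` iter k.+1 S @^-1` A =
    unit_itv R `&` S @^-1` (unit_itv R `&` iter k S @^-1` A) by exact: Sm.
apply/seteqP; split => [x [Xx]|x [Xx [SXx]]]; rewrite /= -iterSr => Ax.
  by split => //; split => //; exact: SX.
by [].
Qed.

(** Cancelling [i] iterates at a common point of two levels leaves a return to [A] at time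
    [j - i < h]. *)
Lemma iter_image_disj h A : (forall j x, (0 < j < h)%N -> A x -> ~ A (iter j S x)) ->
  forall i j, (i < j < h)%N -> iter i S @` A `&` iter j S @` A = set0.
Proof.
move=> nret i j /andP[ij jh]; rewrite -subset0 => _ [[x Ax <-] [y Ay]].
rewrite -(subnKC (ltnW ij)) iterD => /(@iter_inj_preserving i) yx.
by apply: (nret (j - i)%N y); rewrite ?yx//; lia.
Qed.

Lemma vol_iter_tower h A : measurable A -> A `<=` unit_itv R ->
  (forall j x, (0 < j < h)%N -> A x -> ~ A (iter j S x)) ->
  vol (\bigcup_(k < h) (iter k S @` A)) = h%:R * vol A.
Proof.
move=> mA AX nret; rewrite vol_tower//.
- rewrite (eq_bigr (fun=> vol A)).
    by rewrite sumr_const card_ord mulr_natl.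
  by move=> k _; case: (iter_image_preserving k mA AX).
- by move=> k; case: (iter_image_preserving k mA AX).
- exact: iter_image_disj.
Qed.

(** Without any return the images of [A] are disjoint and of equal volume, and enough of them exceed
    the volume 1 of [0,1). *)
Lemma poincare A : measurable A -> A `<=` unit_itv R -> 0 < vol A ->
  exists2 h, (0 < h)%N & exists2 x, A x & A (iter h S x).
Proof.
move=> mA AX A0; apply: contrapT => nret.
have [n nA] : exists n : nat, 1 < n%:R * vol A.
  exists (Num.bound (vol A)^-1); rewrite -ltr_pdivrMr// div1r.
  by apply: archi_boundP; rewrite invr_ge0 ltW.
have := vol_iter_tower (h := n) mA AX.
move=> H; have := nA; rewrite -H; last first.
  by move=> j x /andP[j0 _] Ax Aj; apply: nret; exists j => //; exists x.
rewrite ltNge vol_le1//; apply: bigcup_measurable => k _.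
by case: (iter_image_preserving k mA AX).
Qed.

End preserving.

(** [[u, v[] is the base and [h] the height of a column of a Kakutani-Rokhlin tower over [[p,
    q[]. *)
Definition return_piece (p q u v : R) (h : nat) :=
  [/\ p <= u, u < v, v <= q, (0 < h)%N &
    [/\ forall k, (k <= h)%N -> exists t, forall x, u <= x < v -> iter k S x = x + t,
        forall x, u <= x < v -> p <= iter h S x < q &
        forall j x, (0 < j < h)%N -> u <= x < v -> ~ p <= iter j S x < q]].

(* The backward orbit of [d] enters ]p, q[ for the first time at [c]. *)
Definition first_entry p q d c :=
  p < c < q /\ exists2 k, iter k S c = d &
    forall j, (0 < j <= k)%N -> ~ p < iter j S c < q.

Hypothesis pwt : piecewise_translation D S.

Lemma piecewise_translation_preserving : measure_preserving_injection.
Proof. by case: pwt. Qed.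
Let pS := piecewise_translation_preserving.

(** If [c'] needs more steps than [c] to reach [d], its orbit passes through [c], which lies in []p,
    q[], at a positive time; this is forbidden. *)
Lemma first_entry_uniq p q d c c' :
  first_entry p q d c -> first_entry p q d c' -> c = c'.
Proof.
move=> [cpq [k kd kn]] [cpq' [k' kd' kn']].
wlog kk : c c' k k' cpq cpq' kd kn kd' kn' / (k <= k')%N.
  move=> wl; have [kk|/ltnW kk] := leqP k k'.
    exact: (wl c c' k k').
  by apply/esym; exact: (wl c' c k' k).
have : iter (k' - k) S c' = c.
  apply: (iter_inj_preserving pS (k:=k)).
  by rewrite -iterD subnKC// kd' kd.
have [->//|kk'] := eqVneq k k'; first by rewrite subnn.
move=> cc; case: (kn' (k' - k)%N); last by rewrite cc.
by move: kk kk'; lia.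
Qed.

(* Cut [p, q[ at the first backward entries of the endpoints p, q and of the
   break points in D: between two cuts, an iterate that has not yet returned
   contains no break point, and a returning one does not straddle p or q. *)
Lemma return_pieces p q : p < q -> `[p, q[%classic `<=` unit_itv R ->
  exists L : seq (R * R * nat), [/\ (size L <= (size D).+3)%N,
    forall x, p <= x < q -> exists2 l, l \in L & l.1.1 <= x < l.1.2 &
    forall l, l \in L -> return_piece p q l.1.1 l.1.2 l.2].
Proof.
move=> pq JX.
(* At most [size D + 2] cuts, hence [size D + 3] pieces: the bound does not depend on [p] and
   [q]. *)
have [s [ss sB]] := functional_image_seq (p :: q :: D) (@first_entry_uniq p q).
have [L [sL Lc LP]] := itv_split s pq.
suff /choice[f fP] : forall l, exists h, l \in L -> return_piece p q l.1 l.2 h.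
  exists [seq (l, f l) | l <- L]; split.
  - by rewrite size_map (leq_trans sL).
  - move=> x /Lc[l lL lx]; exists (l, f l) => //.
    by apply/mapP; exists l.
  - by move=> _ /mapP[l lL ->] /=; exact: fP.
move=> [u v]; have [lL|nl] := boolP ((u, v) \in L); last by exists 0%N.
have [/= pu uv vq nos] := LP _ lL.
have IX : `[u, v[%classic `<=` unit_itv R.
  move=> x; rewrite /= in_itv/= => /andP[ux xv]; apply: JX.
  by rewrite /= in_itv/= (le_trans pu)// (lt_le_trans xv).
have [u0 v1] : 0 <= u /\ v <= 1.
  split.
    have : unit_itv R u by apply: IX; rewrite /= in_itv/= lexx uv.
    by rewrite /unit_itv /= in_itv/= => /andP[].
  rewrite leNgt; apply/negP => v1.
  have : unit_itv R (Num.max u 1).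
    by apply: IX; rewrite /= in_itv/= le_max lexx/= gt_max uv v1.
  by rewrite /unit_itv /= in_itv/= => /andP[_]; rewrite gt_max ltxx andbF.
(* The return time of the piece will be the least time at which some point of it returns; recurrence
   of [[u, v[] to itself shows that there is one. *)
have exh : exists h, (0 < h)%N && `[< exists2 x, u <= x < v & p <= iter h S x < q >].
  have [|h h0 [x Ix Ihx]] := poincare pS (measurable_itv `[u, v[) IX.
    by rewrite vol_itv ?subr_gt0// ltW.
  exists h; rewrite h0; apply/asboolP; exists x; first by move: Ix; rewrite /= in_itv.
  move: Ihx; rewrite /= in_itv/= => /andP[uh hv].
  by rewrite (le_trans pu)// (lt_le_trans hv).
case: (ex_minnP exh) => h /andP[h0 /asboolP[y Iy Jy]] hmin.
have nret j x : (0 < j < h)%N -> u <= x < v -> ~ p <= iter j S x < q.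
  move=> /andP[j0 jh] Ix Jx.
  have : (h <= j)%N by apply: hmin; rewrite j0; apply/asboolP; exists x.
  by rewrite leqNgt jh.
(* Up to time [h], no interior point reaches an end or a break point, since it would be a first
   entry and so a cut. At time [h] itself, [d] must be known to lie outside []p, q[]. *)
have nentry k d c : (k <= h)%N -> d \in p :: q :: D -> u < c < v -> iter k S c = d ->
    (k = h -> ~ p < d < q) -> False.
  move=> kh dD /andP[uc cv] ckd khd.
  have cpq : p < c < q by rewrite (le_lt_trans pu)// (lt_le_trans cv).
  have /(sB _ _ dD) cs : first_entry p q d c.
    split => //; exists k => // j /andP[j0 jk].
    have [jh|hj] := ltnP j h.
      move=> /andP[pj jq]; apply: (nret j c); rewrite ?j0 ?(ltW uc) ?(ltW pj)//.
    have kE : k = h by apply/eqP; rewrite eqn_leq kh (leq_trans hj jk).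
    have jE : j = k by apply/eqP; rewrite eqn_leq jk kE.
    by rewrite jE ckd; exact: khd.
  by apply: (nos c cs); rewrite uc.
have transl k : (k <= h)%N -> exists t, forall x, u <= x < v -> iter k S x = x + t.
  elim: k => [|k IH] kh; first by exists 0 => x _; rewrite addr0.
  have [t tP] := IH (ltnW kh).
  case: pwt => _ _ _ _ /(_ (u + t) (v + t)) [||t' t'P].
  - move=> z; rewrite /= in_itv/= => /andP[uz zv].
    rewrite (_ : z = iter k S (z - t)); last by rewrite tP ?subrK//; lra.
    by apply: iter_unit_itv => //; apply: IX; rewrite /= in_itv/=; lra.
  - move=> d dD /andP[ud dv]; apply: (@nentry k d (d - t)); first exact: ltnW.
    + by rewrite !inE dD !orbT.
    + by lra.
    + by rewrite tP ?subrK//; lra.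
    + by move: kh => /[swap] ->; rewrite ltnn.
  - exists (t + t') => x Ix /=; rewrite tP// t'P ?addrA//.
    by move: Ix => /andP[ux xv]; lra.
exists h => _; split => //; split => // x Ix.
have [t tP] := transl h (leqnn h).
move: Jy; rewrite !tP// => /andP[py yq].
move: (Ix) (Iy) => /andP[ux xv] /andP[uy yv].
rewrite leNgt ltNge; apply/andP; split; apply/negP => bad.
- apply: (@nentry h p (p - t)); rewrite ?inE ?eqxx//; first lra.
    by rewrite tP ?subrK//; lra.
  by rewrite ltxx.
- apply: (@nentry h q (q - t)); rewrite ?inE ?eqxx ?orbT//; first lra.
    by rewrite tP ?subrK//; lra.
  by rewrite ltxx andbF.
Qed.

End dynamics.

(** * Rigid towers *)

Lemma sum_pigeonhole (R : realFieldType) (I : eqType) (L : seq I) (f : I -> R)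
    (a : R) (N : nat) : (size L <= N)%N -> 0 < a -> a <= \sum_(l <- L) f l ->
  exists2 l, l \in L & a <= N%:R * f l.
Proof.
move=> LN a0 aL; apply: contrapT => nex.
have lt_a l : l \in L -> N%:R * f l < a.
  by move=> lL; rewrite ltNge; apply/negP => afl; apply: nex; exists l.
have [L0|[l lL]] : L = [::] \/ exists l, l \in L.
- by case: (L) => [|l ?]; [left|right; exists l; rewrite mem_head].
- by move: aL; rewrite L0 big_nil leNgt a0.
have : \sum_(l <- L | l \in L) N%:R * f l < \sum_(l <- L | l \in L) a.
  by apply: ltr_sum => //; apply/hasP; exists l.
rewrite -!big_seq -big_distrr/= big_const_seq count_predT iter_addr_0.
apply/negP; rewrite -leNgt (le_trans _ (ler_wpM2l _ aL))//.
by rewrite mulr_natl ler_pMn2l.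
Qed.

Section towers.
Context {R : realType} (S : R -> R).

(** The images of [Z] decrease and all have its volume, so their intersection [Z'] has it too; [Z']
    is exactly invariant, as ergodicity requires. *)
Lemma ergodic_forward_invariant (Z : set R) :
  measure_preserving_injection S -> ergodic S -> measurable Z ->
  Z `<=` unit_itv R -> S @` Z `<=` Z -> 0 < vol Z -> vol Z = 1.
Proof.
move=> pS eS mZ ZX SZ Z0; pose F k := iter k S @` Z; pose Z' := \bigcap_k F k.
have [mF vF] : (forall k, measurable (F k)) /\ forall k, vol (F k) = vol Z.
  by split=> k; case: (iter_image_preserving pS k mZ ZX).
have mZ' : measurable Z' by exact: bigcapT_measurable.
have Z'Z : Z' `<=` Z by move=> x /(_ 0%N Logic.I) [y Zy <-].
have dF : nonincreasing_seq F.
  apply/nonincreasing_seqP => k; apply/subsetPset => _ [x Zx <-].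
  by rewrite iterSr; exists (S x) => //; apply: SZ; exists x.
(* The sets [F k] minus [Z'] decrease to the empty set, while their volume is constantly
   [vol Z - vol Z']. *)
have vZ' : vol Z' = vol Z.
  have vD k : vol (F k `\` Z') = vol Z - vol Z'.
    rewrite -(vF k) (volDI (mF k) mZ') setIC (setIidl _) ?addrK//.
    exact: bigcap_inf.
  have : vol (F k `\` Z') @[k --> \oo] --> 0.
    apply: vol_cvg0.
    - by move=> k; exact: measurableD.
    - by move=> m n mn; apply/subsetPset; apply: setSD; apply/subsetPset/dF.
    - rewrite -subset0 => x Fx; have [_] := Fx 0%N Logic.I; apply => k _.
      by case: (Fx k Logic.I).
  under eq_fun do rewrite vD.
  by move=> /cvg_lim; rewrite lim_cst// => /(_ (@norm_hausdorff _ _)) /subr0_eq.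
have [] := eS Z' mZ'; [exact: subset_trans ZX| | |].
- apply/seteqP; split => [x [Xx] Sx k _|x Z'x]; last first.
    split; first by apply/ZX/Z'Z.
    move=> k _; case: k => [|k].
      by exists (S x) => //; apply: SZ; exists x => //; exact: Z'Z.
    have [z Zz <-] := Z'x k Logic.I; exists z => //.
  have [z Zz] := Sx k.+1 Logic.I; exists z => //.
  by case: pS => Sinj _ _ _; exact: Sinj.
- rewrite volE//; last exact: subset_trans ZX.
  by rewrite vZ' => -[Z0']; move: Z0; rewrite Z0' ltxx.
- by rewrite volE//; [rewrite vZ' => -[]|exact: subset_trans ZX].
Qed.

Context (D : seq R).
Hypotheses (pwt : piecewise_translation D S) (eS : ergodic S).
Let pS := piecewise_translation_preserving pwt.
Let N := (size D).+3.

(** As [S] preserves volume, the two halves of the symmetric difference of [C] and its image are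
    equally large, so the last bound makes [C] almost invariant. *)
Definition rigid_tower (delta e : R) (r : nat) (C : set R) :=
  [/\ measurable C, C `<=` unit_itv R, delta <= vol C,
      forall x, C x -> `|iter r S x - x| <= e &
      vol (S @` C `\` C) <= e].

(** The inequality on [r] makes the rigidity times tend to infinity as [e] tends to 0, so that an
    increasing sequence can be chosen. *)
Lemma exists_rigid_tower e : 0 < e ->
  exists r C, rigid_tower ((N%:R ^+ 2)^-1) e r C /\ 1 <= N%:R * e * r%:R.
Proof.
move=> e0; pose w := Num.min e 1.
have [w0 we w1] : [/\ 0 < w, w <= e & w <= 1].
  by split; rewrite /w ?lt_min ?e0 ?ltr01// ge_min lexx ?orbT.
have N0 : 0 < N%:R :> R by rewrite ltr0n.
have JX : `[0, w[%classic `<=` unit_itv R.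
  by move=> x; rewrite /unit_itv /= !in_itv/= => /andP[-> /lt_le_trans]; exact.
have [L [sL Lc LP]] := return_pieces pwt w0 JX.
pose I (l : R * R * nat) : set R := `[l.1.1, l.1.2[%classic.
have mI l : measurable (I l) by exact: measurable_itv.
have II l x : I l x = (l.1.1 <= x < l.1.2) by rewrite /I /= in_itv.
have IJ l x : l \in L -> I l x -> 0 <= x < w.
  move=> /LP [p1 p2 p3 _ _]; rewrite II => /andP[lx xl].
  by rewrite (le_trans p1 lx) (lt_le_trans xl p3).
have IX l : l \in L -> I l `<=` unit_itv R.
  by move=> lL x /(IJ _ _ lL) xw; apply: JX; rewrite /= in_itv.
pose tower l := \bigcup_(k < l.2) (iter k S @` I l).
have mtower l : l \in L -> measurable (tower l).
  move=> lL; apply: bigcup_measurable => k _.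
  by case: (iter_image_preserving pS k (mI l) (IX l lL)).
pose Z := \bigcup_(l in [set` L]) tower l.
have mZ : measurable Z.
  by apply: fin_bigcup_measurable => //; exact: mtower.
have ZX : Z `<=` unit_itv R.
  by move=> x [l lL [k _]]; apply: (iter_image_sub pS); exact: IX.
have vI l : l \in L -> vol (I l) = l.1.2 - l.1.1.
  move=> lL; have [p1 p2 p3 _ _] := LP _ lL.
  by rewrite vol_itv//; [exact: ltW|exact: le_trans w1].
have JZ x : 0 <= x < w -> Z x.
  move=> /Lc[l lL lx]; exists l => //; exists 0%N => /=; first by case: (LP _ lL).
  by exists x; rewrite ?II.
(* A point below the top level moves up one level; a point of the top level falls back into [[0,
   w[], which the bases cover. *)
have SZ : S @` Z `<=` Z.
  move=> _ [_ [l lL [k /= kl [y Iy <-]]] <-].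
  have [kl'|kl'] := ltnP k.+1 l.2.
    by exists l => //; exists k.+1 => //; exists y.
  have [_ _ _ _ [_ ret _]] := LP _ lL.
  apply: JZ; rewrite -iterS (_ : k.+1 = l.2); last by apply/eqP; rewrite eqn_leq kl kl'.
  by apply: ret; rewrite -II.
have Z1 : vol Z = 1.
  apply: ergodic_forward_invariant => //.
  have : vol `[0, w[ <= vol Z.
    by apply: le_vol => //; move=> x; rewrite /= in_itv; exact: JZ.
  by rewrite vol_itv ?subr0 ?(ltW w0)//; exact: lt_le_trans.
have [l lL l1] : exists2 l, l \in L & 1 <= N%:R * vol (tower l).
  by apply: (sum_pigeonhole sL) => //; rewrite -Z1; apply: le_vol_sum => //.
have [p1 p2 p3 h0 [transl _ nret]] := LP _ lL.
have uvX := IX _ lL.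
have [L2 [sL2 Lc2 LP2]] := return_pieces pwt p2 uvX.
have [l' lL2 l'1] : exists2 l', l' \in L2 & l.1.2 - l.1.1 <= N%:R * vol (I l').
  apply: (sum_pigeonhole (f := fun l' => vol (I l')) sL2); first by rewrite subr_gt0.
  by rewrite -vI//; apply: le_vol_sum.
have [q1 q2 q3 r0 [_ ret' _]] := LP2 _ lL2.
have I'I : I l' `<=` I l.
  by move=> x; rewrite !II => /andP[lx xl]; rewrite (le_trans q1 lx) (lt_le_trans xl q3).
have I'X : I l' `<=` unit_itv R by exact: subset_trans uvX.
have wl : l.1.2 - l.1.1 <= w by lra.
have vI' : vol (I l') <= w.
  by apply: le_trans wl; rewrite -vI//; exact: le_vol.
have nretI A j x : A `<=` I l -> (0 < j < l.2)%N -> A x -> ~ A (iter j S x).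
  move=> AI jl /AI; rewrite II => Ax /AI Ay; apply: (nret j x) => //.
  exact: IJ Ay.
pose C := \bigcup_(k < l.2) (iter k S @` I l').
have mk k : measurable (iter k S @` I l') /\ vol (iter k S @` I l') = vol (I l').
  exact: iter_image_preserving.
have mC : measurable C by apply: bigcup_measurable => k _; case: (mk k).
(* A return to [I l] is also a return to [[0, w[], so it does not precede the first return time
   [l.2]. *)
have hr : (l.2 <= l'.2)%N.
  rewrite leqNgt; apply/negP => rl.
  apply: (nretI (I l) l'.2 l'.1.1) => //; rewrite ?r0// ?II.
    by rewrite q1 (lt_le_trans q2).
  by apply: ret'; rewrite lexx q2.
have vt : vol (tower l) = l.2%:R * (l.1.2 - l.1.1).
  by rewrite vol_iter_tower ?vI//; move=> j x; exact: nretI.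
exists l'.2, C; split; last first.
  apply: le_trans l1 _; rewrite vt -mulrA; apply: ler_wpM2l; first exact: ltW.
  rewrite mulrC; apply: ler_pM => //.
  - by rewrite subr_ge0 ltW.
  - exact: le_trans we.
  - by rewrite ler_nat.
split => //.
- by move=> x [k _]; apply: (iter_image_sub pS).
- have -> : vol C = l.2%:R * vol (I l').
    by rewrite vol_iter_tower//; move=> j x; exact: nretI.
  rewrite -[leLHS]mul1r ler_pdivrMr ?exprn_gt0//.
  apply: le_trans l1 _; rewrite vt expr2.
  rewrite (_ : _ * (N%:R * N%:R) = N%:R * (l.2%:R * (N%:R * vol (I l')))); last by ring.
  by apply: ler_wpM2l; [exact: ltW|exact: ler_wpM2l].
(* [S^r] commutes with [S^k], which translates all of [I l]. Both [y] and [S^r y] lie in [I l], so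
   their distance, less than its length, is unchanged at level [k]. *)
- move=> _ [k /= kl [y I'y <-]].
  have [t tP] := transl k (ltnW kl).
  rewrite -iterD addnC iterD.
  have Iy := I'I _ I'y; rewrite II in Iy; rewrite II in I'y.
  have Iry := ret' _ I'y.
  rewrite !tP// ler_distl; move: Iy Iry => /andP[? ?] /andP[? ?].
  by apply/andP; split; lra.
(* Only the top level of [C] can leave [C], and its image has the volume of the base [I l']. *)
- apply: le_trans (le_trans vI' we); rewrite -(mk l.2).2; apply: le_vol.
  + apply: measurableD => //.
    by case: pS => _ _ /(_ C mC) []// x [k _]; apply: (iter_image_sub pS).
  + by case: (mk l.2).
  + move=> x [[_ [k /= kl [y Iy <-]] <-] nC].
    have [kl'|kl'] := ltnP k.+1 l.2.
      by case: nC; exists k.+1 => //; exists y.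
    by exists y => //; rewrite -iterS; congr (iter _ S y); apply/eqP; rewrite eqn_leq kl kl'.
Qed.

End towers.

(** * Equidistribution of almost invariant sets *)

Section dominated_charge.
Context {R : realType} (s : set R -> R) (K : R).
Hypothesis sU : forall A B, measurable A -> measurable B -> A `&` B = set0 ->
  s (A `|` B) = s A + s B.
Hypothesis sK : forall A, measurable A -> `|s A| <= K * vol A.

Lemma dominated_additive0 : s set0 = 0.
Proof. by apply/eqP; rewrite -normr_le0 (le_trans (sK measurable0))// vol0 mulr0. Qed.

(** Domination by [K * vol] upgrades finite additivity: the tails of a disjoint union have volume
    tending to 0. *)
Lemma dominated_semi_sigma_additive :
  semi_sigma_additive (fun A : set (measurableTypeR R) => (s A)%:E).
Proof.
move=> F mF tF mUF; pose U n := \big[setU/set0]_(i < n) F i.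
have mU n : measurable (U n) by apply: bigsetU_measurable.
have UE n : (\sum_(0 <= i < n) (s (F i))%:E)%E = (s (U n))%:E.
  elim: n => [|n IH]; first by rewrite big_geq// /U big_ord0 dominated_additive0.
  rewrite big_nat_recr//= IH /U big_ord_recr/= sU ?EFinD//.
  - exact: mU.
  - exact: mF.
  rewrite -bigcup_mkord setI_bigcupl bigcup0// => i /= ni.
  rewrite -subset0 => x Fx; have := tF i n Logic.I Logic.I.
  by move=> /(_ (ex_intro _ x Fx)) iE; rewrite iE ltnn in ni.
under eq_fun do rewrite UE.
apply/cvg_EFin; first exact: nearW.
have DE n : s (\bigcup_k F k `\` U n) = s (\bigcup_k F k) - s (U n).
  have UF : U n `<=` \bigcup_k F k by exact: bigsetU_bigcup.
  rewrite -{2}(setUIDK (\bigcup_k F k) (U n)) (setIidr UF) sU//.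
  - by rewrite addrC addKr.
  - exact: mU.
  - exact: measurableD mUF (mU n).
  - by rewrite setDE setICA setICr setI0.
have cvD : s (\bigcup_k F k `\` U n) @[n --> \oo] --> 0.
  have cv : K * vol (\bigcup_k F k `\` U n) @[n --> \oo] --> 0.
    rewrite -(mulr0 K); apply: cvgMr; apply: vol_cvg0.
    - by move=> n; exact: measurableD mUF (mU n).
    - move=> m n mn; apply/subsetPset; apply: setDS.
      rewrite /U -!bigcup_mkord; apply: bigcup_sub => i /= im.
      by apply: bigcup_sup => /=; exact: leq_trans mn.
    - rewrite -subset0 => x Fx; have [[k _ Fkx] _] := Fx 0%N Logic.I.
      have [_] := Fx k.+1 Logic.I; apply.
      by rewrite /U -bigcup_mkord; exists k => /=.
  apply: (squeeze_cvgr (f := fun n => - (K * vol (\bigcup_k F k `\` U n))) _ _ cv).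
    by apply: nearW => n; rewrite -ler_norml sK//; exact: measurableD mUF (mU n).
  by rewrite -oppr0; exact: cvgN.
have -> : fine \o (fun n => (s (U n))%:E) =
    (fun n => s (\bigcup_k F k) - s (\bigcup_k F k `\` U n)).
  by apply/funext => n /=; rewrite DE subKr.
by rewrite -[X in _ --> X]subr0; apply: cvgB => //; exact: cvg_cst.
Qed.

Lemma dominated_charge : exists nu : {charge set (measurableTypeR R) -> \bar R},
  forall A, nu A = (s A)%:E.
Proof.
pose f (A : set (measurableTypeR R)) := (s A)%:E.
have f0 : f set0 = 0%E by rewrite /f dominated_additive0.
have ffin : forall A, measurable A -> f A \is a fin_num by [].
pose cm := isCharge.Build _ (measurableTypeR R) R f f0 ffin dominated_semi_sigma_additive.
pose nu : {charge set (measurableTypeR R) -> \bar R} := HB.pack f cm.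
by exists nu.
Qed.

(* If M is the negative part of a Hahn decomposition of s, the union of the
   images of M is again negative, and it is forward invariant, hence conull. *)
Lemma ergodic_invariant_sign (S : R -> R) : measure_preserving_injection S -> ergodic S ->
  (forall A, measurable A -> A `<=` unit_itv R -> s (S @` A) = s A) ->
  s (unit_itv R) < 0 ->
  forall A, measurable A -> A `<=` unit_itv R -> s A <= 0.
Proof.
move=> pS eS sS sX A mA AX.
have mX := @measurable_unit_itv R.
have [nu nuE] := dominated_charge.
have [P [M [[mP posP] [mM negM] PM _]]] := Hahn_decomposition nu.
have mMX : measurable (M `&` unit_itv R) by exact: measurableI.
have MXX : M `&` unit_itv R `<=` unit_itv R by exact: subIsetr.
pose Z := \bigcup_k (iter k S @` (M `&` unit_itv R)).
have siter k B : measurable B -> B `<=` unit_itv R -> s (iter k S @` B) = s B.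
  move=> mB BX; elim: k => [|k IH]; first by rewrite image_id.
  rewrite iter_imageS sS//; first by case: (iter_image_preserving pS k mB BX).
  exact: iter_image_sub.
have [mZ negZ] : negative_set nu Z.
  apply: bigcup_negative_set => k; split.
    by case: (iter_image_preserving pS k mMX MXX).
  (* [B] is pulled back to a subset [B'] of [M], where [s] is nonpositive; invariance gives
     [s B = s B']. *)
  move=> B mB BM; pose B' := M `&` (unit_itv R `&` iter k S @^-1` B).
  have mB' : measurable B'.
    by apply: measurableI => //; exact: iter_preimage_measurable.
  have B'X : B' `<=` unit_itv R by move=> x [_ []].
  have -> : B = iter k S @` B'.
    apply/seteqP; split => [y By|_ [x [_ [_ Bx]] <-]//].
    by have [x [Mx Xx] xy] := BM _ By; exists x; rewrite // /B' /= xy.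
  by rewrite nuE siter// -nuE; apply: negM => // x [].
have sP B : measurable B -> B `<=` unit_itv R `\` Z -> 0 <= s B.
  move=> mB BZ; rewrite -lee_fin -nuE; apply: posP => // x /BZ[Xx nZ].
  have : (P `|` M) x by rewrite PM.
  by case=> // Mx; case: nZ; exists 0%N => //; exists x.
have sZ B : measurable B -> B `<=` Z -> s B <= 0.
  by move=> mB BZ; rewrite -lee_fin -nuE; exact: negZ.
have s0 B : measurable B -> vol B = 0 -> s B = 0.
  by move=> mB vB; apply/eqP; rewrite -normr_le0 (le_trans (sK mB))// vB mulr0.
have ssplit B : measurable B -> s B = s (B `&` Z) + s (B `\` Z).
  move=> mB; rewrite -sU ?setUIDK//; [exact: measurableI|exact: measurableD|].
  by rewrite setDE setIACA setICr setI0.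
have vZ : vol Z = 1.
  apply: (ergodic_forward_invariant pS eS) => //.
  - by move=> x [k _]; exact: iter_image_sub.
  - by move=> _ [_ [k _ [x Mx <-]] <-]; exists k.+1 => //; exists x.
  (* Were [Z] null, [s] of [0,1) would equal [s] of the complement of [Z], which is nonnegative
     because it lies in [P]. *)
  - rewrite lt_neqAle vol_ge0 andbT eq_sym; apply/eqP => vZ0.
    move: sX; rewrite ssplit// s0 ?add0r; [|exact: measurableI|].
      by rewrite ltNge sP//; exact: measurableD.
    apply/eqP; rewrite eq_le vol_ge0 andbT -vZ0; apply: le_vol => //.
    exact: measurableI.
rewrite ssplit// [X in _ + X]s0 ?addr0; [|exact: measurableD|].
  by apply: sZ; [exact: measurableI|exact: subIsetr].
apply/eqP; rewrite eq_le vol_ge0 andbT.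
have := volDI mX mZ; rewrite vol_unit setIC (setIidl _) ?vZ.
  move=> XZ; have : vol (A `\` Z) <= vol (unit_itv R `\` Z).
    by apply: le_vol; [exact: measurableD|exact: measurableD|exact: setSD].
  by move/le_trans; apply; lra.
by move=> x [k _]; exact: iter_image_sub.
Qed.

End dominated_charge.

Lemma ultra_fmap (T U : Type) (f : T -> U) (F : set_system T) :
  UltraFilter F -> UltraFilter (f @ F).
Proof.
move=> FU; split; first exact: fmap_proper_filter.
move=> G GF FG; apply/seteqP; split=> [A GA|]; last exact: FG.
have [//|nA] := in_ultra_setVsetC (f @^-1` A) FU.
have GnA : G (~` A) by apply: FG.
by have /filter_ex[x []] : G (A `&` ~` A) by exact: filterI.
Qed.

Lemma ultra_bounded_cvg (R : realType) (U : set_system nat) (u : nat -> R) a b :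
  UltraFilter U -> (forall n, a <= u n <= b) -> cvg (u n @[n --> U]).
Proof.
move=> UU ub; have := @segment_compact R a b; rewrite compact_ultra.
move=> /(_ _ (ultra_fmap u UU)) [|l [_ ul]]; last by apply/cvg_ex; exists l.
change (U (u @^-1` `[a, b]%classic)).
by apply: filterS filterT => n _; rewrite /= in_itv; exact: ub.
Qed.

Section almost_invariant.
Context {R : realType} (S : R -> R) (C : nat -> set R) (c : R).
Hypotheses (pS : measure_preserving_injection S) (eS : ergodic S).
Hypotheses (mC : forall n, measurable (C n)) (CX : forall n, C n `<=` unit_itv R).
Hypotheses (c0 : 0 < c) (vC : forall n, c <= vol (C n)).
Hypothesis SC : vol (S @` C n `\` C n) @[n --> \oo] --> 0.

Let mI n A : measurable A -> measurable (C n `&` A).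
Proof. by move=> mA; exact: measurableI. Qed.

Lemma almost_invariantI n A : measurable A -> A `<=` unit_itv R ->
  `|vol (C n `&` S @` A) - vol (C n `&` A)| <= vol (S @` C n `\` C n).
Proof.
move=> mA AX; case: (pS) => Sinj _ Sp _.
have [mSA vSA] := Sp _ mA AX; have [mSC vSC] := Sp _ (mC n) (@CX n).
have <- : vol (S @` (C n `&` A)) = vol (C n `&` A).
  by case: (Sp (C n `&` A)) => //; [exact: mI|move=> x [/CX]].
have -> : S @` (C n `&` A) = S @` C n `&` S @` A.
  apply/seteqP; split => [_ [x [Cx Ax] <-]|y [[x Cx xy] [z Az zy]]].
    by split; exists x.
  exists x => //; split => //; rewrite (_ : x = z)//.
  by apply: Sinj; rewrite xy zy.
set Y := S @` C n; set B := S @` A.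
have YI : vol (Y `\` C n) = vol (C n `\` Y).
  have h1 := volDI mSC (mC n); have h2 := volDI (mC n) mSC.
  by move: h1 h2; rewrite vSC (setIC (C n)) -/Y => -> /addIr.
have half E F : measurable E -> measurable F -> vol (E `&` B) - vol (F `&` B) <= vol (E `\` F).
  move=> mE mF; rewrite lerBlDl.
  apply: (le_trans (y := vol (F `&` B `|` (E `\` F)))).
    apply: le_vol.
    - exact: measurableI.
    - by apply: measurableU; [exact: measurableI|exact: measurableD].
    - by move=> x [Ex Bx]; have [Fx|nFx] := pselect (F x); [left|right].
  by apply: le_volU; [exact: measurableI|exact: measurableD].
rewrite ler_norml; apply/andP; split; last by rewrite YI; exact: half.
by rewrite lerNl opprB; exact: half.
Qed.

(** Along an ultrafilter carried by the bad indices, the traces of [C n] converge to an invariant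
    [nu]. Comparing [nu] with [c / 2 * vol] through [ergodic_invariant_sign] contradicts the choice
    of those indices. *)
Lemma almost_invariant_equidistributed A (eta : R) : measurable A -> A `<=` unit_itv R ->
  0 < eta -> \forall n \near \oo, c / 2 * vol A - eta <= vol (C n `&` A).
Proof.
move=> mA AX eta0; apply: contrapT => nev.
pose G := [set n | vol (C n `&` A) < c / 2 * vol A - eta].
(* The negated claim says that [G] meets every tail of the indices. *)
have FP : ProperFilter (within G \oo).
  apply: Build_ProperFilter => G0; apply: nev.
  change (\oo [set n | G n -> False]) in G0.
  apply: (@filterS _ _ _ [set n | G n -> False]) G0 => n /= nG.
  by rewrite leNgt; apply/negP.
have [U [UU FU]] := ultraFilterLemma FP.
have UG : U G by apply: FU; apply: nearW.
have Uoo : \oo `<=` U.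
  move=> E Eoo; apply: FU; change (\oo [set x | G x -> E x]).
  by apply: (@filterS _ \oo _ E) => // x Ex _.
pose nu B : R := lim (vol (C n `&` B) @[n --> U]).
have cvnu B : measurable B -> vol (C n `&` B) @[n --> U] --> nu B.
  move=> mB; apply: (ultra_bounded_cvg (a := 0) (b := 1)) => // n.
  by rewrite vol_ge0 vol_le1//; exact: mI.
have nu_le B x : measurable B -> (U [set n | vol (C n `&` B) <= x]) -> nu B <= x.
  by move=> mB Ux; exact: cvgr_to_le (cvnu B mB) Ux.
have nu_ge B x : measurable B -> (forall n, x <= vol (C n `&` B)) -> x <= nu B.
  by move=> mB Ux; apply: (cvgr_to_ge (cvnu B mB)); exact: nearW.
(* Since [nu] of [0,1) is at least [c], the factor 1/2 makes [s] strictly negative there. As [nu]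
   lies between 0 and [vol], [s] is dominated with constant [c / 2 + 1]. *)
pose s B := c / 2 * vol B - nu B.
have nuU B E : measurable B -> measurable E -> B `&` E = set0 -> nu (B `|` E) = nu B + nu E.
  move=> mB mE BE; have := cvgD (cvnu B mB) (cvnu E mE).
  have -> : (fun n => vol (C n `&` B)) + (fun n => vol (C n `&` E)) =
      fun n => vol (C n `&` (B `|` E)).
    apply/funext => n /=; rewrite setIUr volU//; [exact: mI|exact: mI|].
    by rewrite setIACA BE setI0.
  move=> cv; exact: cvg_unique (cvnu _ (measurableU _ _ mB mE)) (cv _).
suff : s A <= 0.
  rewrite /s subr_le0; apply/negP; rewrite -ltNge.
  apply: (@le_lt_trans _ _ (c / 2 * vol A - eta)); last by rewrite ltrBlDr ltrDl.
  by apply: nu_le => //; apply: filterS UG => n /ltW.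
apply: (@ergodic_invariant_sign _ s (c / 2 + 1) _ _ S) => //.
- move=> B E mB mE BE; rewrite /s volU// nuU//; ring.
- move=> B mB; rewrite /s; apply: le_trans (ler_normB _ _) _.
  have nB0 : 0 <= nu B by apply: nu_ge => // n; exact: vol_ge0.
  have cB0 : 0 <= c / 2 * vol B by rewrite mulr_ge0 ?vol_ge0// divr_ge0// ltW.
  rewrite !ger0_norm// mulrDl mul1r lerD2l; apply: nu_le => //.
  apply: filterS filterT => n _ /=; apply: le_vol => //; exact: mI.
- move=> B mB BX; rewrite /s; have [mSB ->] : measurable (S @` B) /\ vol (S @` B) = vol B.
    by case: pS => _ _ /(_ B mB BX).
  congr (_ - _); apply/eqP; rewrite -subr_eq0; apply/eqP.
  have SCU : vol (S @` C n `\` C n) @[n --> U] --> 0 by move=> V /SC /Uoo.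
  have d0 : vol (C n `&` S @` B) - vol (C n `&` B) @[n --> U] --> 0.
    apply: (squeeze_cvgr (f := fun n => - vol (S @` C n `\` C n)) _ _ SCU).
      by apply: filterS filterT => n _; rewrite -ler_norml almost_invariantI.
    by rewrite -oppr0; exact: cvgN.
  by apply: (cvg_unique _ (cvgB (cvnu _ mSB) (cvnu _ mB)) d0); exact: norm_hausdorff.
- rewrite /s vol_unit mulr1.
  have : c <= nu (unit_itv R).
    apply: nu_ge => [|n]; first exact: measurable_unit_itv.
    by rewrite (setIidl _).
  by move: c0; lra.
Qed.

End almost_invariant.

(** * Partial rigidity *)

Lemma le_limn_einf (R : realType) (x : R) (u : nat -> \bar R) :
  (forall eta, 0 < eta -> \forall n \near \oo, ((x - eta)%:E <= u n)%E) ->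
  (x%:E <= limn_einf u)%E.
Proof.
move=> xu; apply/lee_subgt0Pr => eta /xu[N _ Nu].
rewrite -EFinB limn_einf_lim.
have -> : limn (einfs u) = ereal_sup (range (einfs u)).
  exact/cvg_lim/cvg_einfs_sup.
apply: le_trans (ereal_sup_ubound (_ : range (einfs u) (einfs u N))); last by exists N.
apply: le_ereal_inf_tmp => _ [n /= Nn <-]; exact: Nu.
Qed.

Section rigidity.
Context {R : realType} (S : R -> R).
Hypothesis pS : measure_preserving_injection S.

(** [B] omits the points of [A] within [1 / (k + 1)] of the complement of [U]. As [U] is open, these
    decrease to the empty set, so their volume tends to 0. *)
Lemma inner_points_cvg (A U : set R) : measurable A -> open U -> A `<=` U ->
  forall eta, 0 < eta -> exists rho B, [/\ 0 < rho, measurable B, B `<=` A,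
    vol (A `\` B) < eta & forall x y, B x -> `|y - x| < rho -> U y].
Proof.
move=> mA oU AU eta eta0.
pose V k := \bigcup_(y in ~` U) ball y (k.+1%:R^-1).
have k0 k : 0 < k.+1%:R^-1 :> R by rewrite invr_gt0.
have mV k : measurable (V k).
  by apply: open_measurable; apply: bigcup_open => y _; exact: ball_open.
have dV : nonincreasing_seq V.
  move=> m n mn; apply/subsetPset => x [y Uy yx]; exists y => //.
  by apply: le_ball yx; rewrite lef_pV2 ?posrE// ler_nat.
have mAV k : measurable (A `&` V k) by exact: measurableI.
have cv : vol (A `&` V k) @[k --> \oo] --> 0.
  apply: vol_cvg0 => //.
    by move=> m n mn; apply/subsetPset; apply: setIS; apply/subsetPset/dV.
  rewrite -subset0 => x AVx.
  have [Ax _] := AVx 0%N Logic.I.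
  have /nbhs_ballP[e /= e0 eU] : nbhs x U by apply: open_nbhs_nbhs; split => //; exact: AU.
  have [k ke] : exists k, k.+1%:R^-1 < e.
    exists (Num.bound e^-1); rewrite invf_plt ?posrE//.
    by apply: (lt_le_trans (archi_boundP _)); rewrite ?ler_nat// invr_ge0 ltW.
  have [_ [y Uy yx]] := AVx k Logic.I; apply: Uy; apply: eU.
  by apply: ball_sym; apply: le_ball yx; exact: ltW.
have [k _ /(_ k (leqnn k)) /= vk] := cvgr_lt _ cv _ eta0.
exists k.+1%:R^-1, (A `\` V k); split => //.
- exact: measurableD.
- by rewrite setDD.
- by move=> x y [Ax nVx] yx; apply: contrapT => nUy; apply: nVx; exists y.
Qed.

(** Once the displacement on [C n] is below [rho], points of [B] in [C n] stay in the open set [U],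
    and so land in [A] or in the small set [U] minus [A]. *)
Lemma tower_rigidity (c : R) (m : nat -> nat) (C : nat -> set R) :
  ergodic S -> 0 < c ->
  (forall n, rigid_tower S c (n.+1%:R^-1) (m n) (C n)) ->
  forall A, measurable A -> A `<=` unit_itv R -> forall eta, 0 < eta ->
  \forall n \near \oo, c / 2 * vol A - eta <= vol (A `&` iter (m n) S @` A).
Proof.
move=> eS c0 tC A mA AX eta eta0.
(* One third each for [U] minus [A], for [A] minus [B], and for equidistribution. *)
have eta3 : 0 < eta / 3 by rewrite divr_gt0.
have [U [oU AU UA]] : exists U : set R,
    [/\ open U, A `<=` U & (lebesgue_measure (U `\` A) < (eta / 3)%:E)%E].
  by apply: lebesgue_regularity_outer => //; rewrite [X in (X < _)%E](volE mA AX) ltry.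
have mU : measurable U by exact: open_measurable.
have vUA : vol (U `\` A) < eta / 3.
  rewrite -lte_fin; apply: le_lt_trans UA; rewrite -volEI; last exact: measurableD.
  apply: measureIl; [exact: measurableD|exact: measurable_unit_itv].
have [rho [B [rho0 mB BA vAB BU]]] := inner_points_cvg mA oU AU eta3.
have mC n : measurable (C n) by case: (tC n).
have SC0 : vol (S @` C n `\` C n) @[n --> \oo] --> 0.
  apply: (squeeze_cvgr (f := fun=> 0) _ (cvg_cst _) (@cvg_harmonic R)).
  by apply: nearW => n; rewrite vol_ge0 /=; case: (tC n).
have CX n : C n `<=` unit_itv R by case: (tC n).
have vC n : c <= vol (C n) by case: (tC n).
have ev := almost_invariant_equidistributed pS eS mC CX c0 vC SC0 mA AX eta3.
have small : \forall n \near \oo, n.+1%:R^-1 < rho.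
  exact: cvgr_lt _ (@cvg_harmonic R) _ rho0.
near=> n.
have cn : c / 2 * vol A - eta / 3 <= vol (C n `&` A) by near: n.
have nrho : n.+1%:R^-1 < rho by near: n.
have [_ _ _ Cclose _] := tC n.
have BX : B `<=` unit_itv R by exact: subset_trans AX.
have mBC : measurable (B `&` C n) by exact: measurableI.
have BCX : B `&` C n `<=` unit_itv R by move=> x [/BX].
have [mSBC vSBC] := iter_image_preserving pS (m n) mBC BCX.
have [mSA _] := iter_image_preserving pS (m n) mA AX.
have mI : measurable (A `&` iter (m n) S @` A) by exact: measurableI.
have le1 : vol (B `&` C n) <= vol (A `&` iter (m n) S @` A) + vol (U `\` A).
  rewrite -vSBC; apply: le_trans (le_volU mI (measurableD mU mA)).
  apply: le_vol => //; first by apply: measurableU => //; exact: measurableD.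
  move=> _ [x [Bx Cx] <-]; have [Ax|nAx] := pselect (A (iter (m n) S x)).
    by left; split => //; exists x => //; exact: BA.
  right; split => //; apply: BU Bx _.
  exact: le_lt_trans (Cclose x Cx) nrho.
have le2 : vol (C n `&` A) <= vol (B `&` C n) + vol (A `\` B).
  apply: le_trans (le_volU mBC (measurableD mA mB)); apply: le_vol => //.
  - exact: measurableI.
  - by apply: measurableU => //; exact: measurableD.
  - by move=> x [Cx Ax]; have [Bx|nBx] := pselect (B x); [left|right].
lra.
Unshelve. all: by end_near. Qed.

End rigidity.

Lemma exists_rigid_tower_sequence (R : realType) (S : R -> R) (D : seq R) :
  piecewise_translation D S -> ergodic S ->
  exists c m C, [/\ 0 < c, increasing_seq (m : nat -> nat) &
    forall n, rigid_tower S c (n.+1%:R^-1) (m n) (C n)].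
Proof.
move=> pwt eS; pose N := (size D).+3; pose c : R := (N%:R ^+ 2)^-1.
have N0 : 0 < N%:R :> R by rewrite ltr0n.
have c0 : 0 < c by rewrite invr_gt0 exprn_gt0.
have ex (p : nat * nat) : exists q : nat * set R,
    (p.2 < q.1)%N /\ rigid_tower S c (p.1.+1%:R^-1) q.1 q.2.
  (* The first term gives the tolerance of stage [n]; the second turns [1 <= N e r] into [M < r]. *)
  case: p => n M /=; pose e : R := Num.min n.+1%:R^-1 (N%:R * M.+1%:R)^-1.
  have NM0 : 0 < N%:R * M.+1%:R :> R by rewrite mulr_gt0.
  have e0 : 0 < e by rewrite lt_min !invr_gt0 NM0 ltr0n.
  have [r [C [[mC CX cC Cr SC] r1]]] := exists_rigid_tower pwt eS e0.
  have en : e <= n.+1%:R^-1 by rewrite ge_min lexx.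
  exists (r, C); split => /=.
    rewrite -(ler_nat R) -[leLHS]mul1r -ler_pdivlMr//.
    apply: le_trans r1 _; rewrite [leRHS]mulrC ler_wpM2r//.
    rewrite -ler_pdivlMl// -invfM; rewrite /e ge_min; apply/orP; right.
    by [].
  split => //; last exact: le_trans en.
  by move=> x /Cr/le_trans; apply.
have [f fP] := choice ex.
(* Each stage passes on its rigidity time as the lower bound [M] of the next one. *)
pose g := fix g n := if n is k.+1 then f (k.+1, (g k).1) else f (0%N, 0%N).
exists c, (fun n => (g n).1), (fun n => (g n).2); split => //.
- by apply/increasing_seqP => n; have [] := fP (n.+1, (g n).1).
- by case=> [|n]; [have [] := fP (0%N, 0%N)|have [] := fP (n.+1, (g n).1)].
Qed.

Theorem proposition6p8 (R : realType) (T : R -> R)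
    (hT : interval_exchange T) (herg : ergodic T) :
  partially_rigid T.
Proof.
have [D [S [pwt ST]]] := iet_piecewise_translation hT.
have pS := piecewise_translation_preserving pwt.
have eS : ergodic S.
  move=> A mA AX SA; apply: herg => //; rewrite -{2}SA.
  by apply/seteqP; split => x [Xx Ax]; split => //; move: Ax; rewrite /= ST.
have [c [m [C [c0 im tC]]]] := exists_rigid_tower_sequence pwt eS.
exists (c / 2), m; split => //; first by rewrite divr_gt0.
move=> A mA AX.
have iterE k : iter k T @` A = iter k S @` A.
  apply: eq_imagel => x /AX Xx; elim: k => //= k ->; rewrite ST//.
  exact: iter_unit_itv.
rewrite volE// -EFinM; apply: le_limn_einf => eta eta0.
apply: filterS (tower_rigidity pS eS c0 tC mA AX eta0) => n; rewrite iterE.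
rewrite -lee_fin -volE//; last by move=> x [/AX].
by apply: measurableI => //; case: (iter_image_preserving pS (m n) mA AX).
Qed.
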